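(* Let $R\subseteq S$ be rings and let $M$ be a right $S$-module. Then $\mathrm{End}(M_S)$ is a semi-invariant subring of $\mathrm{End}(M_R)$.
   Context: All rings are unital, ring homomorphisms preserve the unity, and subrings share the unity of the ambient ring. $\mathrm{End}(M_R)$ and $\mathrm{End}(M_S)$ are the rings of $R$-linear and $S$-linear endomorphisms of $M$. A subring $A_0$ of a ring $A$ is semi-invariant if there is a ring $B\supseteq A$ and a set $\Sigma$ of ring endomorphisms of $B$ such that $A_0=\{a\in A:\sigma(a)=a\ \text{for all }\sigma\in\Sigma\}$. *)

(* Defs.v *)
From HB Require Import structures.
From mathcomp Require Import all_boot all_algebra.
From mathcomp Require Import boolp classical_sets.

Set Implicit Arguments.
Unset Strict Implicit.
Unset Printing Implicit Defensive.

Import GRing.Theory.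

Local Open Scope ring_scope.

(* Rings are [pzRingType]s: not necessarily commutative, possibly zero.
   MathComp only has left modules, so a right S-module is a left module over
   the converse ring S^c, with m . s written [(s : S^c) *: m]. *)

Section EndomorphismRing.

Variables (K : pzRingType) (V : lmodType K).

Definition endo : Type := {linear V -> V}.

Definition endo_fun (f : endo) : V -> V := (f : {linear V -> V}).

Coercion endo_fun : endo >-> Funclass.

HB.instance Definition _ (f : endo) :=
  GRing.Linear.copy (endo_fun f) (f : {linear V -> V}).

HB.instance Definition _ := gen_eqMixin endo.
HB.instance Definition _ := gen_choiceMixin endo.

Lemma endoP (f g : endo) : f =1 g -> f = g.
Proof.
rewrite /endo_fun; case: f => f [[af] [sf]]; case: g => g [[ag] [sg]] /=.
move=> /funext efg; case: _ / efg ag sg => ag sg.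
by rewrite (Prop_irrelevance af ag) (Prop_irrelevance sf sg).
Qed.

Definition endo_zero : endo := (\0 : {linear V -> V}).
Definition endo_opp (f : endo) : endo := (\- f : {linear V -> V}).
Definition endo_add (f g : endo) : endo := (f \+ g : {linear V -> V}).
Definition endo_one : endo := (idfun : {linear V -> V}).
Definition endo_mul (f g : endo) : endo := (f \o g : {linear V -> V}).

Fact endo_addA : associative endo_add.
Proof. by move=> f g h; apply: endoP => v; apply: addrA. Qed.

Fact endo_addC : commutative endo_add.
Proof. by move=> f g; apply: endoP => v; apply: addrC. Qed.

Fact endo_add0 : left_id endo_zero endo_add.
Proof. by move=> f; apply: endoP => v; apply: add0r. Qed.

Fact endo_addN : left_inverse endo_zero endo_opp endo_add.
Proof. by move=> f; apply: endoP => v; apply: addNr. Qed.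

Fact endo_mulA : associative endo_mul.
Proof. by move=> f g h; apply: endoP. Qed.

Fact endo_mul1 : left_id endo_one endo_mul.
Proof. by move=> f; apply: endoP. Qed.

Fact endo_mulr1 : right_id endo_one endo_mul.
Proof. by move=> f; apply: endoP. Qed.

Fact endo_mulDl : left_distributive endo_mul endo_add.
Proof. by move=> f g h; apply: endoP. Qed.

Fact endo_mulDr : right_distributive endo_mul endo_add.
Proof. by move=> f g h; apply: endoP => v; apply: (raddfD (f : {linear V -> V})). Qed.

HB.instance Definition _ := GRing.isPzRing.Build endo
  endo_addA endo_addC endo_add0 endo_addN
  endo_mulA endo_mul1 endo_mulr1 endo_mulDl endo_mulDr.

End EndomorphismRing.

(* The right R-module M_R obtained from a right S-module M by restriction of
   scalars along iota : R -> S, i.e. m . r := m . iota r. *)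
Definition restrict_scalars (R S : pzRingType) (iota : {rmorphism R -> S})
  (M : lmodType S^c) : Type := M.

Section RestrictionOfScalars.

Variables (R S : pzRingType) (iota : {rmorphism R -> S}) (M : lmodType S^c).

Local Notation M_R := (restrict_scalars iota M).

HB.instance Definition _ := GRing.Zmodule.copy M_R M.

Definition restrict_scale (r : R^c) (m : M_R) : M_R :=
  (iota r : S^c) *: (m : M).

Fact restrict_scaleA a b m :
  restrict_scale a (restrict_scale b m) = restrict_scale (a * b) m.
Proof. by rewrite /restrict_scale scalerA; congr (_ *: _); rewrite rmorphM. Qed.

Fact restrict_scale1 : left_id 1 restrict_scale.
Proof. by move=> m; rewrite /restrict_scale rmorph1; apply: scale1r. Qed.

Fact restrict_scaleDr : right_distributive restrict_scale +%R.
Proof. by move=> a m n; apply: scalerDr. Qed.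

Fact restrict_scaleDl m : {morph restrict_scale^~ m : a b / a + b}.
Proof. by move=> a b; rewrite /restrict_scale rmorphD; apply: scalerDl. Qed.

HB.instance Definition _ := GRing.Zmodule_isLmodule.Build R^c M_R
  restrict_scaleA restrict_scale1 restrict_scaleDr restrict_scaleDl.

(* End(M_S), viewed as a subset of End(M_R). *)
Definition endo_sub : set (endo M_R) :=
  [set f | exists g : endo M, forall m : M, f m = g m].

End RestrictionOfScalars.

Arguments endo_sub {R S} iota M.

(* An overring B of A is given by an injective ring morphism j : A -> B. *)
Definition semi_invariant (A : pzRingType) (A0 : set A) : Prop :=
  subring_closed (mem A0) /\
  exists (B : pzRingType) (j : {rmorphism A -> B})
         (Sigma : set {rmorphism B -> B}),
    injective j /\
    A0 = [set a : A | forall sigma, Sigma sigma -> sigma (j a) = j a]%classic.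

(* Main.v *)
(** Every [s : S] gives the additive automorphism [(m, n) |-> (m + n . s, n)]
    of [M * M], and the diagonal action of an additive map [f : M -> M]
    commutes with it exactly when [f (n . s) = f n . s] for all [n].  Hence
    End(M_S) is the set of elements of End(M_R), embedded diagonally in
    B = End_Z(M * M), fixed by all the conjugations by these automorphisms. *)
Require Import Defs.
From HB Require Import structures.
From mathcomp Require Import all_boot all_algebra.
From mathcomp Require Import boolp classical_sets.

Set Implicit Arguments.
Unset Strict Implicit.
Unset Printing Implicit Defensive.

Import GRing.Theory.

Local Open Scope ring_scope.

(** Every abelian group is a module over [int] and additive maps are [int]-linear, so [endo V^z] is
    the ring of all additive endomorphisms of [V]. *)
Local Notation "M ^z" := (zmodule M) (format "M ^z") : type_scope.

Section Conjugation.

Variables (B : pzRingType) (u v : B) (uv1 : u * v = 1) (vu1 : v * u = 1).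

(** The two equations are arguments so that the ring morphism structure, whose multiplicativity
    relies on them, can be attached to the function itself. *)
Definition conj_by of u * v = 1 & v * u = 1 := fun b : B => u * b * v.

Local Notation conj_uv := (conj_by uv1 vu1).

Fact conj_by_is_zmod_morphism : zmod_morphism conj_uv.
Proof. by move=> a b; rewrite /conj_by mulrBr mulrBl. Qed.

Fact conj_by_is_monoid_morphism : monoid_morphism conj_uv.
Proof.
split=> [|a b]; rewrite /conj_by; first by rewrite mulr1.
by rewrite !mulrA -[u * a * v * u]mulrA vu1 mulr1.
Qed.

HB.instance Definition _ :=
  GRing.isZmodMorphism.Build B B conj_uv conj_by_is_zmod_morphism.
HB.instance Definition _ :=
  GRing.isMonoidMorphism.Build B B conj_uv conj_by_is_monoid_morphism.

Lemma conj_by_fixedP (b : B) : conj_uv b = b <-> u * b = b * u.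
Proof.
rewrite /conj_by; split=> [fix_b | ->]; last by rewrite -mulrA uv1 mulr1.
by rewrite -[in RHS]fix_b -mulrA vu1 mulr1.
Qed.

End Conjugation.

(** For a unit [u], commuting with [u] means being fixed by conjugation by [u]. Hence [Sigma] can be
    taken to be the conjugations by all [u i]. *)
Lemma unit_centralizer_semi_invariant (A B : pzRingType) (j : {rmorphism A -> B})
    (I : Type) (u v : I -> B) (A0 : set A) :
    injective j -> (forall i, u i * v i = 1) -> (forall i, v i * u i = 1) ->
    (forall a, A0 a <-> forall i, u i * j a = j a * u i) ->
  semi_invariant A0.
Proof.
move=> j_inj uv1 vu1 A0P; split.
  have memP a : a \in mem A0 <-> forall i, u i * j a = j a * u i.
    by rewrite -A0P; split=> [/[!inE]|aA]; last exact: mem_set.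
  split=> [|a b /memP ca /memP cb|a b /memP ca /memP cb]; apply/memP => i.
  - by rewrite rmorph1 mulr1 mul1r.
  - by rewrite rmorphB mulrBr mulrBl ca cb.
  - by rewrite rmorphM mulrA ca -mulrA cb mulrA.
exists B, j.
exists [set sigma | exists i,
  sigma = (conj_by (uv1 i) (vu1 i) : {rmorphism B -> B})]%classic.
split=> //; apply/seteqP; split=> a /=.
  by move=> /A0P ca _ [i ->]; apply/conj_by_fixedP.
move=> fix_a; apply/A0P => i; apply/(conj_by_fixedP (uv1 i) (vu1 i)).
by apply: (fix_a (conj_by (uv1 i) (vu1 i))); exists i.
Qed.

Section AdditiveEndo.

Variables (V : zmodType) (f : V -> V).

Definition additive_endo_fun of zmod_morphism f : V^z -> V^z := f.

Hypothesis f_add : zmod_morphism f.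

Fact additive_endo_is_zmod_morphism : zmod_morphism (additive_endo_fun f_add).
Proof. exact: f_add. Qed.

HB.instance Definition _ := GRing.isZmodMorphism.Build V^z V^z
  (additive_endo_fun f_add) additive_endo_is_zmod_morphism.

Fact additive_endo_is_scalable : scalable (additive_endo_fun f_add).
Proof. exact: raddf_int_scalable. Qed.

HB.instance Definition _ := GRing.isScalable.Build int V^z V^z *:%R
  (additive_endo_fun f_add) additive_endo_is_scalable.

Definition additive_endo : endo V^z :=
  (additive_endo_fun f_add : {linear V^z -> V^z}).

End AdditiveEndo.

Section Transvection.

Variables (K : pzRingType) (V : lmodType K).

(** This is the unipotent matrix with rows (1, s) and (0, 1) acting on columns. Over a
    noncommutative [K] it is in general only additive, hence the passage to [(V * V)^z]. *)
Definition transvection_fun (s : K) (p : V * V) : V * V :=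
  (p.1 + s *: p.2, p.2).

Fact transvection_is_zmod_morphism s : zmod_morphism (transvection_fun s).
Proof.
by move=> p q; congr (_, _); rewrite /= scalerBr opprD addrACA.
Qed.

Definition transvection s : endo (V * V)^z :=
  additive_endo (transvection_is_zmod_morphism s).

Lemma transvectionNK s : transvection s * transvection (- s) = 1.
Proof.
by apply: endoP => -[m n]; congr (_, _); rewrite /= scaleNr subrK.
Qed.

Lemma transvectionKN s : transvection (- s) * transvection s = 1.
(* Writing the second [s] as [- - s] turns the goal into the previous identity at [- s]. *)
Proof. by rewrite -{2}[s]opprK transvectionNK. Qed.

End Transvection.

Section Diagonal.

Variables (K : pzRingType) (V : lmodType K).

Definition diagonal_fun (f : endo V) (p : V * V) : V * V := (f p.1, f p.2).

Fact diagonal_fun_is_zmod_morphism f : zmod_morphism (diagonal_fun f).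
Proof. by move=> p q; congr (_, _); apply: raddfB. Qed.

Definition diagonal (f : endo V) : endo (V * V)^z :=
  additive_endo (diagonal_fun_is_zmod_morphism f).

Fact diagonal_is_zmod_morphism : zmod_morphism diagonal.
Proof. by move=> f g; apply: endoP. Qed.

Fact diagonal_is_monoid_morphism : monoid_morphism diagonal.
Proof. by split=> [|f g]; apply: endoP => // -[]. Qed.

HB.instance Definition _ := GRing.isZmodMorphism.Build
  (endo V) (endo (V * V)^z) diagonal diagonal_is_zmod_morphism.
HB.instance Definition _ := GRing.isMonoidMorphism.Build
  (endo V) (endo (V * V)^z) diagonal diagonal_is_monoid_morphism.

Lemma diagonal_inj : injective diagonal.
Proof.
move=> f g eq_fg; apply: endoP => m.
exact: (congr1 (fun h : endo (V * V)^z => (h (m, m)).1) eq_fg).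
Qed.

End Diagonal.

Section RestrictedEndo.

Variables (R S : pzRingType) (iota : {rmorphism R -> S}) (M : lmodType S^c).
Variable f : endo (restrict_scalars iota M).

(** The map is unchanged; the proof of scalability is carried along so that the [S^c]-linear
    structure can be attached to it. *)
Definition extended_endo_fun of scalable (f : M -> M) : M -> M := f.

Hypothesis fZ : scalable (f : M -> M).

Fact extended_endo_is_zmod_morphism : zmod_morphism (extended_endo_fun fZ).
Proof. exact: (raddfB f). Qed.

HB.instance Definition _ := GRing.isZmodMorphism.Build M M
  (extended_endo_fun fZ) extended_endo_is_zmod_morphism.
HB.instance Definition _ := GRing.isScalable.Build S^c M M *:%R
  (extended_endo_fun fZ) fZ.

Lemma scalable_endo_sub : endo_sub iota M f.
Proof. by exists (extended_endo_fun fZ : {linear M -> M}). Qed.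

End RestrictedEndo.

Lemma endo_subP (R S : pzRingType) (iota : {rmorphism R -> S})
    (M : lmodType S^c) (f : endo (restrict_scalars iota M)) :
  endo_sub iota M f <-> scalable (f : M -> M).
Proof.
split=> [[g fg] s m | ]; last exact: scalable_endo_sub.
by rewrite !fg; apply: linearZ.
Qed.

Section CommuteDiagonal.

Variables (R S : pzRingType) (iota : {rmorphism R -> S}) (M : lmodType S^c).

Local Notation M_R := (restrict_scalars iota M).

(** At [(m, n)] the two products have first coordinates [f m + s *: f n] and [f (m + s *: n)], and
    the same second coordinate [f n]; additivity of [f] reduces the comparison to [n]. *)
Lemma scalable_commute_diagonalP (f : endo M_R) :
  scalable (f : M -> M) <->
  forall s, (transvection M s : endo (M_R * M_R)^z) * diagonal f
    = diagonal f * (transvection M s : endo (M_R * M_R)^z).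
Proof.
split=> [fZ s | comm s m].
  apply: endoP => -[m n]; congr (_, _).
  by rewrite /= -fZ; apply/esym/(raddfD f).
(* Evaluating at [(0, m)] isolates the off-diagonal term, since [f 0 = 0]. *)
have := congr1 (fun h : endo (M_R * M_R)^z => (h (0, m)).1) (comm s).
have f0 : f 0 = 0 := raddf0 f.
by rewrite /= f0 !add0r.
Qed.

End CommuteDiagonal.

Theorem proposition3p6 (R S : pzRingType) (iota : {rmorphism R -> S})
    (iota_inj : injective iota) (M : lmodType S^c) :
  semi_invariant (endo_sub iota M).
Proof.
pose M_R := restrict_scalars iota M.
(* Restriction of scalars keeps the additive group, so transvections by all scalars of [S^c] act on
   [M_R * M_R], although [M_R] is only an [R^c]-module. *)
apply: (@unit_centralizer_semi_invariant _ _
  (@diagonal _ M_R : {rmorphism endo M_R -> endo (M_R * M_R)^z}) S^c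
  (fun s => transvection M s) (fun s => transvection M (- s))).
- exact: diagonal_inj.
- exact: transvectionNK.
- exact: transvectionKN.
- by move=> f; rewrite endo_subP; apply: scalable_commute_diagonalP.
Qed.
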